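(* Let $p$ be a prime and let $G$ be a finite $2$-generator $p$-group of nilpotency class two. Then $Z^*(G)=Z_2^*(G)$.
   Context: A group $G$ is $c$-capable ($c\ge1$) if $G\cong H/Z_c(H)$ for some group $H$, where $Z_c(H)$ is the $c$-th term of the upper central series of $H$; capable means $1$-capable. The epicenter $Z^*(G)$ is the smallest central subgroup $N$ of $G$ such that $G/N$ is capable. The $2$-epicenter $Z_2^*(G)$ is the smallest normal subgroup $N$ of $G$ contained in $Z_2(G)$ such that $G/N$ is $2$-capable. *)

(* Defs.v *)
From HB Require Import structures.
From mathcomp Require Import all_boot all_fingroup all_solvable.
From mathcomp Require Import generic_quotient boolp.

Set Implicit Arguments.
Unset Strict Implicit.
Unset Printing Implicit Defensive.

Local Open Scope group_scope.
Local Open Scope quotient_scope.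

(* The group H in the definition of c-capability ranges over all groups,
   possibly infinite, whereas 'Z_n(G) and G / N are only available inside a
   finite group type; hence the quotient and the upper central series of an
   arbitrary groupType. Membership predicates are boolean by classical
   reasoning, so they denote arbitrary subsets. *)

Record normalSubgroup (H : groupType) := NormalSubgroup {
  nsub_mem : {pred H};
  nsub1 : 1 \in nsub_mem;
  nsubM : forall x y, x \in nsub_mem -> y \in nsub_mem -> x * y \in nsub_mem;
  nsubV : forall x, x \in nsub_mem -> x^-1 \in nsub_mem;
  nsubJ : forall x y, x \in nsub_mem -> x ^ y \in nsub_mem
}.

Section QuotientGroup.

Variables (H : groupType) (N : normalSubgroup H).

Definition coset_rel : rel H := fun x y => x^-1 * y \in nsub_mem N.

Lemma coset_rel_equiv : equiv_class_of coset_rel.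
Proof.
split=> [x|x y|y x z] /=; rewrite /coset_rel.
- by rewrite mulVg nsub1.
- by apply/idP/idP=> /nsubV; rewrite invgM invgK.
- by move=> xy yz; rewrite -[z](mulVKg y) mulgA nsubM.
Qed.

Canonical coset_equiv := EquivRelPack coset_rel_equiv.

Definition quotient_group := {eq_quot coset_equiv}.

HB.instance Definition _ := Choice.on quotient_group.
HB.instance Definition _ := EqQuotient.on quotient_group.

Definition quotient_pi (x : H) : quotient_group := \pi x.

Lemma quotient_piP x y :
  reflect (quotient_pi x = quotient_pi y) (x^-1 * y \in nsub_mem N).
Proof. exact: (eqmodP coset_equiv x y). Qed.

Lemma quotient_pi_repr (u : quotient_group) : quotient_pi (repr u) = u.
Proof. exact: reprK. Qed.

Definition quotient_one : quotient_group := quotient_pi 1.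
Definition quotient_inv (u : quotient_group) : quotient_group :=
  quotient_pi (repr u)^-1.
Definition quotient_mul (u v : quotient_group) : quotient_group :=
  quotient_pi (repr u * repr v).

Lemma quotient_mul_pi x y :
  quotient_mul (quotient_pi x) (quotient_pi y) = quotient_pi (x * y).
Proof.
apply/quotient_piP; rewrite invgM.
have /quotient_piP := quotient_pi_repr (quotient_pi x).
have /quotient_piP := quotient_pi_repr (quotient_pi y).
set a := repr _; set b := repr _ => Ny Nx.
have -> : a^-1 * b^-1 * (x * y) = (a^-1 * y) * (b^-1 * x) ^ y.
  by rewrite /conjg !mulgA mulgK.
by rewrite nsubM ?nsubJ.
Qed.

Lemma quotient_inv_pi x : quotient_inv (quotient_pi x) = quotient_pi x^-1.
Proof.
apply/quotient_piP; rewrite invgK.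
have /esym/quotient_piP := quotient_pi_repr (quotient_pi x).
set a := repr _ => Nx.
have -> : a * x^-1 = (x^-1 * a) ^ x^-1.
  by rewrite /conjg invgK !mulgA mulgV mul1g.
exact: nsubJ.
Qed.

Lemma quotient_mulA : associative quotient_mul.
Proof.
move=> u v w; rewrite -(quotient_pi_repr u) -(quotient_pi_repr v).
by rewrite -(quotient_pi_repr w) !quotient_mul_pi mulgA.
Qed.

Lemma quotient_mul1g : left_id quotient_one quotient_mul.
Proof. by move=> u; rewrite -(quotient_pi_repr u) quotient_mul_pi mul1g. Qed.

Lemma quotient_mulg1 : right_id quotient_one quotient_mul.
Proof. by move=> u; rewrite -(quotient_pi_repr u) quotient_mul_pi mulg1. Qed.

Lemma quotient_mulVg : left_inverse quotient_one quotient_inv quotient_mul.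
Proof.
move=> u; rewrite -(quotient_pi_repr u).
by rewrite quotient_inv_pi quotient_mul_pi mulVg.
Qed.

Lemma quotient_mulgV : right_inverse quotient_one quotient_inv quotient_mul.
Proof.
move=> u; rewrite -(quotient_pi_repr u).
by rewrite quotient_inv_pi quotient_mul_pi mulgV.
Qed.

HB.instance Definition _ := isGroup.Build quotient_group
  quotient_mulA quotient_mul1g quotient_mulg1 quotient_mulVg quotient_mulgV.

Lemma quotient_piM : {morph quotient_pi : x y / x * y}.
Proof. by move=> x y; rewrite -quotient_mul_pi. Qed.

Lemma quotient_piV : {morph quotient_pi : x / x^-1}.
Proof. by move=> x; rewrite -quotient_inv_pi. Qed.

Definition center_preim : {pred H} :=
  [pred x | `[< forall u : quotient_group, commute (quotient_pi x) u >]].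

Lemma center_preimP x :
  reflect (forall u : quotient_group, commute (quotient_pi x) u)
          (x \in center_preim).
Proof. exact: asboolP. Qed.

Lemma center_preim1 : 1 \in center_preim.
Proof. by apply/center_preimP=> u; apply/commute_sym/commute1. Qed.

Lemma center_preimM x y :
  x \in center_preim -> y \in center_preim -> x * y \in center_preim.
Proof.
move=> /center_preimP Zx /center_preimP Zy; apply/center_preimP=> u.
by rewrite quotient_piM; apply/commute_sym/commuteM; apply/commute_sym.
Qed.

Lemma center_preimV x : x \in center_preim -> x^-1 \in center_preim.
Proof.
move=> /center_preimP Zx; apply/center_preimP=> u.
by rewrite quotient_piV; apply/commute_sym/commuteV/commute_sym.
Qed.

Lemma center_preimJ x y : x \in center_preim -> x ^ y \in center_preim.
Proof.
move=> /center_preimP Zx; apply/center_preimP=> u.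
suff -> : quotient_pi (x ^ y) = quotient_pi x by apply: Zx.
by rewrite /conjg !quotient_piM quotient_piV Zx mulKg.
Qed.

End QuotientGroup.

Definition trivial_normal (H : groupType) : normalSubgroup H.
Proof.
exists (pred1 1) => [|x y|x|x y]; rewrite !inE ?eqxx //.
- by move=> /eqP-> /eqP->; rewrite mulg1.
- by move=> /eqP->; rewrite invg1.
- by move=> /eqP->; rewrite conj1g.
Defined.

Definition center_above (H : groupType) (N : normalSubgroup H) :
    normalSubgroup H :=
  NormalSubgroup (center_preim1 N) (@center_preimM H N) (@center_preimV H N)
                 (@center_preimJ H N).

Definition upper_central (H : groupType) (c : nat) : normalSubgroup H :=
  iter c (@center_above H) (trivial_normal H).

Definition isomorphic (G K : groupType) : Prop :=
  exists f : {multiplicative G -> K}, bijective f.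

Definition capable (c : nat) (G : groupType) : Prop :=
  exists H : groupType, isomorphic G (quotient_group (upper_central H c)).

Section Epicenter.

Variables (gT : finGroupType) (G : {group gT}).

Definition smallest_group (P : {group gT} -> Prop) (N : {group gT}) : Prop :=
  P N /\ forall M : {group gT}, P M -> N \subset M.

Definition is_epicenter : {group gT} -> Prop :=
  smallest_group (fun N => N \subset 'Z(G) /\ capable 1 (subg_of (G / N))).

Definition is_epicenter2 : {group gT} -> Prop :=
  smallest_group (fun N =>
    [/\ N <| G, N \subset 'Z_2(G) & capable 2 (subg_of (G / N))]).

End Epicenter.

(* Main.v *)
Require Import Defs.
From HB Require Import structures.
From mathcomp Require Import all_boot all_fingroup all_solvable.
From mathcomp Require Import generic_quotient ssralg ssrint boolp.

(* Capability is stable under intersections of kernels, so Z^*(G) exists, and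
   G / N 2-capable implies G / N capable.  What remains is that a capable
   p-group K generated by two elements, with central commutator, is 2-capable.
   Let K = E / Z(E), let x, y in E lift the generators, z = [x, y], and
   D = <z> Z(E), an abelian normal subgroup of E.  We build a group H mapping
   onto E in which D is enlarged to A x D, where A = (D x D) / R with
   R = {([d, y], [d, x]^-1) : d in D}: a lift of x acts on A x D by
   (a, d) |-> (a (d, 1), d^x), a lift of y by (a, d) |-> (a (1, d), d^y).
   These commute precisely because of R, so H exists as an extension of Z^2
   by A x D with [x, y] = (1, z).  The kernel of H -> K lies in Z_2(H) because
   A is central in H, and conversely the kernel contains Z_2(H) provided that
   d |-> (d, 1) and d |-> (1, d) have no common nontrivial kernel element in A.
   Such an element has the form v^k = u^-l with u = [z, x], v = [z, y] central
   and u^k = v^l = 1; as u and v have p-power order, it is trivial. *)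

Set Implicit Arguments.
Unset Strict Implicit.
Unset Printing Implicit Defensive.

Local Open Scope group_scope.

(** * Homomorphisms between arbitrary groups *)

Section MorphismFacts.

Variables (G K : groupType) (f : G -> K).
Hypothesis fM : {morph f : x y / x * y}.

Lemma morph_mul1 : f 1 = 1.
Proof. by apply: (mulgI (f 1)); rewrite -fM !mulg1. Qed.

Lemma morph_mulV : {morph f : x / x^-1}.
Proof. by move=> x; apply: (mulgI (f x)); rewrite -fM !mulgV morph_mul1. Qed.

Lemma morph_mulJ : {morph f : x y / x ^ y}.
Proof. by move=> x y; rewrite /conjg !fM morph_mulV. Qed.

Lemma morph_mulR : {morph f : x y / [~ x, y]}.
Proof. by move=> x y; rewrite /commg fM morph_mulV morph_mulJ. Qed.

Lemma morph_mulX n : {morph f : x / x ^+ n}.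
Proof.
by move=> x; elim: n => [|n IHn]; rewrite ?morph_mul1 // !expgS fM IHn.
Qed.

End MorphismFacts.

(** * Upper central series and capability in terms of elements *)

Lemma center_aboveP (H : groupType) (N : normalSubgroup H) x :
  (x \in nsub_mem (center_above N)) <->
  (forall y, [~ x, y] \in nsub_mem N).
Proof.
have commE y : commute (quotient_pi N x) (quotient_pi N y) <->
    [~ x, y] \in nsub_mem N.
  have -> : [~ x, y] = (y * x)^-1 * (x * y).
    by rewrite /commg /conjg invgM !mulgA.
  rewrite /commute -!quotient_piM; split; first by move/esym/quotient_piP.
  by move/quotient_piP.
split; first by move/center_preimP=> Zx y; apply/commE/Zx.
move=> Nx; apply/center_preimP=> u.
by rewrite -(quotient_pi_repr u); apply/commE/Nx.
Qed.

Lemma upper_central1P (H : groupType) x :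
  (x \in nsub_mem (upper_central H 1)) <-> (forall y, commute x y).
Proof.
split=> [/center_aboveP Zx y | Zx]; first exact/commgP/Zx.
by apply/center_aboveP=> y; apply/commgP/Zx.
Qed.

Lemma upper_central2P (H : groupType) x :
  (x \in nsub_mem (upper_central H 2)) <->
  (forall y t, commute [~ x, y] t).
Proof.
split=> [/center_aboveP Zx y | Zx]; first exact/upper_central1P/Zx.
by apply/center_aboveP=> y; apply/upper_central1P/Zx.
Qed.

Lemma quotient_pi_eq1 (H : groupType) (N : normalSubgroup H) x :
  quotient_pi N x = 1 <-> x \in nsub_mem N.
Proof.
have -> : (x \in nsub_mem N) = (1^-1 * x \in nsub_mem N) by rewrite invg1 mul1g.
by split=> [/esym/quotient_piP | /quotient_piP/esym].
Qed.

(** The first isomorphism theorem: this is the form in which capability is used and established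
    below. *)
Lemma capableP c (K : groupType) :
  capable c K <->
  exists (H : groupType) (f : H -> K),
    [/\ {morph f : x y / x * y}, (forall k, exists h, f h = k)
      & forall h, f h = 1 <-> h \in nsub_mem (upper_central H c)].
Proof.
split=> [[H [g [g' gK g'K]]] | [H [f [fM f_surj f_ker]]]].
  have gM : {morph g : x y / x * y} := @gmulfM _ _ g.
  have g'M := can2_gmulfM gK g'K.
  exists H, (g' \o @quotient_pi H _); split=> [x y | k | h] /=.
  - by rewrite quotient_piM g'M.
  - by exists (repr (g k)); rewrite quotient_pi_repr gK.
  rewrite -quotient_pi_eq1; split=> [g'h1 | ->]; last exact: morph_mul1.
  by rewrite -[LHS]g'K g'h1 (morph_mul1 gM).
pose Q := Defs.quotient_group (upper_central H c).
(* A set-theoretic section of [f], obtained by classical choice; by [f_pi] it becomes a homomorphism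
   modulo [upper_central H c]. *)
pose s k := projT1 (cid (f_surj k)).
have fs k : f (s k) = k by rewrite /s; case: cid.
have f_pi x y :
    f x = f y <-> quotient_pi (upper_central H c) x = quotient_pi _ y.
  split=> [fxy | /quotient_piP/f_ker].
    by apply/quotient_piP/f_ker; rewrite fM morph_mulV // fxy mulVg.
  by rewrite fM morph_mulV // => /(congr1 ( *%g (f x))); rewrite mulVKg mulg1.
pose g k : Q := quotient_pi _ (s k).
have gM : {morph g : x y / x * y}.
  by move=> x y; rewrite /g -quotient_piM; apply/f_pi; rewrite fM !fs.
pose G : {multiplicative K -> Q} := HB.pack g (isMultiplicative.Build K Q g gM).
exists H, G; exists (fun u => f (repr u)) => [k | u] /=.
  by rewrite -[RHS]fs; apply/f_pi; rewrite quotient_pi_repr.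
by rewrite -[RHS]quotient_pi_repr /= /g; apply/f_pi; rewrite fs.
Qed.

(** * Iteration and powers with integer exponents *)

Lemma int_succ_ind (P : int -> Prop) :
  P 0%R -> (forall i, P i <-> P (i + 1)%R) -> forall i, P i.
Proof.
move=> P0 PS; elim/int_rec=> [|n Pn|n Pn]; first exact: P0.
  by rewrite -addn1 PoszD; case: (PS n) => + _; apply.
have [_] := PS (- n.+1%:Z)%R; apply.
by rewrite -addn1 PoszD GRing.opprD GRing.subrK.
Qed.

Section IntIter.

Variables (T : Type) (f g : T -> T).
Hypotheses (fK : cancel f g) (gK : cancel g f).

(** [Negz n] stands for -(n+1), hence the [n.+1] iterations of the inverse. *)
Definition int_iter (i : int) (x : T) : T :=
  match i with Posz n => iter n f x | Negz n => iter n.+1 g x end.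

Lemma int_iterS i x : int_iter (i + 1)%R x = f (int_iter i x).
Proof.
case: i => [n|[|n]]; first by rewrite -PoszD addn1.
  by rewrite /= gK.
have -> : (Negz n.+1 + 1 = Negz n)%R.
  by rewrite !NegzE -[n.+2]addn1 PoszD GRing.opprD GRing.subrK.
by rewrite /= gK.
Qed.

Lemma int_iterD i j x : int_iter (i + j)%R x = int_iter i (int_iter j x).
Proof.
elim/int_succ_ind: i => [|i]; first by rewrite GRing.add0r.
rewrite GRing.addrAC !int_iterS; split=> [-> // | ].
exact: (can_inj fK).
Qed.

Lemma int_iter_inv (S : Type) (h : T -> S) :
  (forall x, h (f x) = h x) -> forall i x, h (int_iter i x) = h x.
Proof.
by move=> hf i x; elim/int_succ_ind: i => [//|i]; rewrite int_iterS hf.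
Qed.

End IntIter.

Section IntPower.

Variable G : groupType.
Implicit Types x y : G.

Definition int_pow x (i : int) : G := int_iter ( *%g x) ( *%g x^-1) i 1.

Lemma int_powS x i : int_pow x (i + 1)%R = x * int_pow x i.
Proof. by apply: int_iterS => y; rewrite mulVKg. Qed.

Lemma int_powD x i j : int_pow x (i + j)%R = int_pow x i * int_pow x j.
Proof.
elim/int_succ_ind: i => [|i]; first by rewrite GRing.add0r mul1g.
rewrite GRing.addrAC !int_powS -mulgA; split=> [-> // | ].
exact: mulgI.
Qed.

Lemma int_pow1 x : int_pow x 1%R = x.
Proof. exact: mulg1. Qed.

End IntPower.

Lemma morph_int_pow (G K : groupType) (f : G -> K) :
  {morph f : x y / x * y} -> forall x i, f (int_pow x i) = int_pow (f x) i.
Proof.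
move=> fM x i; elim/int_succ_ind: i => [|i]; first exact: morph_mul1.
by rewrite !int_powS fM; split=> [-> // | /mulgI].
Qed.

(** * Semidirect products with an infinite cyclic group *)

Record automorphism (M : groupType) := Automorphism {
  aut_fun :> M -> M;
  aut_inv : M -> M;
  aut_M : {morph aut_fun : x y / x * y};
  aut_K : cancel aut_fun aut_inv;
  aut_VK : cancel aut_inv aut_fun
}.

(* The pair (i, m) stands for t^i m, where t generates the infinite cyclic
   factor and m ^ t = s m. *)
Definition semidirect_int (M : groupType) (s : automorphism M) : Type :=
  (int * M)%type.

Section SemidirectInt.

Variables (M : groupType) (s : automorphism M).

Local Notation S := (semidirect_int s).
Local Notation sX := (int_iter s (aut_inv s)).

HB.instance Definition _ := Choice.on S.

Let sXM i : {morph sX i : x y / x * y}.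
Proof.
move=> x y; elim/int_succ_ind: i => [//|i].
rewrite !int_iterS; try exact: aut_VK.
by rewrite -aut_M; split=> [-> // | /(can_inj (@aut_K _ s))].
Qed.

Let sXD i j x : sX (i + j)%R x = sX i (sX j x).
Proof. exact: int_iterD (@aut_K _ s) (@aut_VK _ s) _ _ _. Qed.

(** Read off from t^i m t^j n = t^(i+j) m' n, where m' is the conjugate of m by t^j, that is,
    [sX j m]. *)
Let semi_mul (u v : S) : S := ((u.1 + v.1)%R, sX v.1 u.2 * v.2).
Let semi_one : S := (0%R, 1).
Let semi_inv (u : S) : S := ((- u.1)%R, sX (- u.1)%R u.2^-1).

Let semi_mulA : associative semi_mul.
Proof.
move=> [i m] [j n] [k l]; rewrite /semi_mul /=.
by rewrite GRing.addrA sXM -sXD [(k + j)%R]GRing.addrC mulgA.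
Qed.

Let semi_mul1 : left_id semi_one semi_mul.
Proof.
move=> [i m]; rewrite /semi_mul /= GRing.add0r.
by rewrite (morph_mul1 (sXM i)) mul1g.
Qed.

Let semi_mulr1 : right_id semi_one semi_mul.
Proof. by move=> [i m]; rewrite /semi_mul /= GRing.addr0 mulg1. Qed.

Let semi_mulV : left_inverse semi_one semi_inv semi_mul.
Proof.
move=> [i m]; rewrite /semi_mul /= GRing.addNr.
by rewrite -sXD GRing.addrN mulVg.
Qed.

Let semi_mulrV : right_inverse semi_one semi_inv semi_mul.
Proof.
move=> [i m]; rewrite /semi_mul /= GRing.addrN.
by rewrite -sXM mulgV (morph_mul1 (sXM _)).
Qed.

HB.instance Definition _ := isGroup.Build S
  semi_mulA semi_mul1 semi_mulr1 semi_mulV semi_mulrV.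

Definition semi_in (m : M) : S := (0%R, m).
Definition semi_gen : S := (1%R, 1).

Lemma semi_mulE (u v : S) : u * v = ((u.1 + v.1)%R, sX v.1 u.2 * v.2).
Proof. by []. Qed.

Lemma semi_inM : {morph semi_in : m n / m * n}.
Proof. by []. Qed.

Lemma semi_inJ m : semi_in m ^ semi_gen = semi_in (s m).
Proof.
apply: (mulgI semi_gen); rewrite -conjgC !semi_mulE /=.
by rewrite mulg1 mul1g.
Qed.

Lemma semi_genX i : int_pow semi_gen i = (i, 1).
Proof.
elim/int_succ_ind: i => [//|i]; rewrite int_powS.
have <- : semi_gen * (i, 1) = ((i + 1)%R, 1).
  by rewrite semi_mulE /= mulg1 (morph_mul1 (sXM i)) GRing.addrC.
by split=> [-> // | /mulgI].
Qed.

Lemma semiE u : u = int_pow semi_gen u.1 * semi_in u.2.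
Proof.
by case: u => i m; rewrite semi_genX semi_mulE /= mul1g GRing.addr0.
Qed.

Lemma semi_ext (E : groupType) (f g : S -> E) :
    {morph f : x y / x * y} -> {morph g : x y / x * y} ->
    (forall m, f (semi_in m) = g (semi_in m)) -> f semi_gen = g semi_gen ->
  f =1 g.
Proof.
move=> fM gM fg_in fg_gen u.
by rewrite (semiE u) fM gM !morph_int_pow // fg_in fg_gen.
Qed.

Section Lift.

Variables (E : groupType) (f : M -> E) (e : E).
Hypotheses (fM : {morph f : x y / x * y}) (fs : forall m, f (s m) = f m ^ e).

Definition semi_lift (u : S) : E := int_pow e u.1 * f u.2.

(** Universal property: [fs] says that [e] acts on the image of [M] as t acts on [M], the only
    relation between t and [M]. *)
Lemma semi_liftM : {morph semi_lift : u v / u * v}.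
Proof.
have fsX i m : f (sX i m) = f m ^ int_pow e i.
  elim/int_succ_ind: i => [|i]; first by rewrite conjg1.
  rewrite int_iterS ?fs; last exact: aut_VK.
  rewrite int_powD int_pow1 conjgM.
  by split=> [-> // | /conjg_inj].
move=> [i m] [j n]; rewrite semi_mulE /semi_lift /= int_powD fM fsX.
by rewrite -[RHS]mulgA (mulgA (f m)) (conjgC (f m) (int_pow e j)) !mulgA.
Qed.

Lemma semi_lift_in m : semi_lift (semi_in m) = f m.
Proof. exact: mul1g. Qed.

Lemma semi_lift_gen : semi_lift semi_gen = e.
Proof. by rewrite /semi_lift (morph_mul1 fM) mulg1 int_pow1. Qed.

End Lift.

End SemidirectInt.

(* N is extended by commuting automorphisms sx and sy, with the commutator of
   the two new generators prescribed to be z: first adjoin x, then let y act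
   by sy on N and by x |-> x z. *)
Section SemidirectInt2.

Variables (N : groupType) (sx sy : automorphism N) (z : N).
Hypotheses (NC : forall a b : N, commute a b)
  (sxyC : forall a, sx (sy a) = sy (sx a)).

Let M := semidirect_int sx.
Let N_M : N -> M := @semi_in N sx.
Let X : M := semi_gen sx.

(** [N] is abelian, so [X] and [X * N_M c] act on it alike. Hence [f] extends to an endomorphism of
    [M] sending [X] to [X * N_M c]. *)
Let twist_compat f c : {morph f : a b / a * b} ->
  (forall a, f (sx a) = sx (f a)) ->
  forall a, N_M (f (sx a)) = N_M (f a) ^ (X * N_M c).
Proof.
move=> fM fsx a; rewrite conjgM /N_M semi_inJ fsx.
by rewrite /conjg -!semi_inM -(NC c) mulKg.
Qed.

Let sy_invM : {morph aut_inv sy : a b / a * b}.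
Proof.
by move=> a b; apply: (can_inj (@aut_K _ sy)); rewrite aut_M !aut_VK.
Qed.

Let sx_sy_inv a : sx (aut_inv sy a) = aut_inv sy (sx a).
Proof. by apply: (can_inj (@aut_K _ sy)); rewrite -sxyC !aut_VK. Qed.

Let y_fun : M -> M := semi_lift (N_M \o sy) (X * N_M z).
(** Since [y_fun] sends [X * N_M c] to [X * N_M (z * sy c)], the value at [X] is the one with
    [z * sy c = 1]. *)
Let y_inv : M -> M :=
  semi_lift (N_M \o aut_inv sy) (X * N_M (aut_inv sy z)^-1).

Let y_funM : {morph y_fun : u v / u * v}.
Proof.
apply: semi_liftM => [a b | a] /=; first by rewrite aut_M.
by apply: twist_compat => // ? ?; rewrite aut_M.
Qed.

Let y_invM : {morph y_inv : u v / u * v}.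
Proof.
apply: semi_liftM => [a b | a] /=; first by rewrite sy_invM.
by apply: twist_compat.
Qed.

Let y_fun_in a : y_fun (N_M a) = N_M (sy a).
Proof. exact: semi_lift_in. Qed.

Let y_inv_in a : y_inv (N_M a) = N_M (aut_inv sy a).
Proof. exact: semi_lift_in. Qed.

Let y_fun_gen : y_fun X = X * N_M z.
Proof. by apply: semi_lift_gen => a b /=; rewrite aut_M. Qed.

Let y_inv_gen : y_inv X = X * N_M (aut_inv sy z)^-1.
Proof. by apply: semi_lift_gen => a b /=; rewrite sy_invM. Qed.

Let y_funK : cancel y_fun y_inv.
Proof.
apply: (@semi_ext _ _ _ (y_inv \o y_fun) id) => //= [u v | a |].
- by rewrite /= y_funM y_invM.
- by rewrite y_fun_in y_inv_in aut_K.
- by rewrite y_fun_gen y_invM y_inv_gen y_inv_in -mulgA -semi_inM mulVg mulg1.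
Qed.

Let y_invK : cancel y_inv y_fun.
Proof.
apply: (@semi_ext _ _ _ (y_fun \o y_inv) id) => //= [u v | a |].
- by rewrite /= y_invM y_funM.
- by rewrite y_inv_in y_fun_in aut_VK.
- rewrite y_inv_gen y_funM y_fun_gen y_fun_in (morph_mulV (@aut_M _ sy)) aut_VK.
  by rewrite -mulgA -semi_inM mulgV mulg1.
Qed.

Let y_aut := Automorphism y_funM y_funK y_invK.
Let H := semidirect_int y_aut.
Let i : N -> H := @semi_in M y_aut \o N_M.
Let x : H := semi_in y_aut X.
Let y : H := semi_gen y_aut.

Let y_fun_fst u : (y_fun u).1 = u.1.
Proof.
rewrite /y_fun /semi_lift semi_mulE /= GRing.addr0.
elim/int_succ_ind: u.1 => [//|j]; rewrite int_powS semi_mulE /= GRing.addr0.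
by rewrite GRing.addrC; split=> [-> // | /GRing.addIr].
Qed.

(** The exponents of [x] and [y] are homomorphisms from [H] to the integers, the former because [y]
    preserves it. They vanish on commutators, which leaves only the component in [N]. *)
Let commg_in (g h : H) : exists a, [~ g, h] = i a.
Proof.
have c1 (u v : H) : (u * v).1 = (u.1 + v.1)%R by [].
have c2 (u v : H) : (u * v).2.1 = (u.2.1 + v.2.1)%R.
  rewrite semi_mulE /=; congr (_ + _)%R.
  by apply: (@int_iter_inv _ _ _ _ _ (fun w : M => w.1)) => //; apply: y_invK.
have additive0 (c : H -> int) : (forall u v, c (u * v) = (c u + c v)%R) ->
    c [~ g, h] = 0%R.
  move=> cD; have := congr1 c (commgC g h).
  rewrite !cD [(c h + _)%R]GRing.addrC.
  by rewrite -[LHS]GRing.addr0 => /GRing.addrI.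
exists [~ g, h].2.2; have := additive0 _ c1; have := additive0 _ c2.
by case: [~ g, h] => j [k a] /= -> ->.
Qed.

(** Generation by [u], [v] and the image of [N] is recorded through centralizers, the form in which
    centrality is checked later. The last clause is the universal property. *)
Lemma rank2_extension : exists (G : groupType) (f : N -> G) (u v : G),
  [/\ {morph f : a b / a * b}, injective f, forall a, f a ^ u = f (sx a),
      forall a, f a ^ v = f (sy a) & [~ u, v] = f z] /\
  [/\ forall g h, exists a, [~ g, h] = f a,
      forall t, commute t u -> commute t v -> (forall a, commute t (f a)) ->
        forall g, commute t g
    & forall (E : groupType) (phi : N -> E) e1 e2,
        {morph phi : a b / a * b} -> (forall a, phi (sx a) = phi a ^ e1) ->
        (forall a, phi (sy a) = phi a ^ e2) -> phi z = [~ e1, e2] ->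
      exists psi : G -> E, [/\ {morph psi : a b / a * b},
        forall a, psi (f a) = phi a, psi u = e1 & psi v = e2]].
Proof.
exists H, i, x, y; split; split.
- by move=> a b; rewrite /i /= -!semi_inM.
- by move=> a b [].
- move=> a; rewrite /i /x /= -(morph_mulJ (@semi_inM _ y_aut)).
  by rewrite semi_inJ.
- by move=> a; rewrite /i /= semi_inJ /= y_fun_in.
- rewrite /x /y commgEl semi_inJ /= y_fun_gen.
  by rewrite -(morph_mulV (@semi_inM _ y_aut)) -semi_inM mulKg.
- exact: commg_in.
- move=> t tx ty ti g.
  have tX e j : commute t e -> commute t (int_pow e j).
    move=> te; elim/int_succ_ind: j => [|j]; first exact: commute1.
    rewrite int_powS; split=> [|tej]; first exact: commuteM.
    rewrite -[int_pow e j](mulKg e); apply: commuteM => //.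
    exact: commuteV.
  rewrite (semiE y_aut g) (semiE sx g.2); apply: commuteM; first exact: tX.
  rewrite semi_inM (morph_int_pow (@semi_inM _ y_aut)).
  by apply: commuteM; [apply: tX | apply: ti].
move=> E phi e1 e2 phiM phi_x phi_y phi_z.
pose psi1 : M -> E := semi_lift phi e1.
have psi1M : {morph psi1 : a b / a * b} by apply: semi_liftM.
have psi1_in a : psi1 (N_M a) = phi a by apply: semi_lift_in.
have psi1_gen : psi1 X = e1 by apply: semi_lift_gen.
(* Checked on generators; at [X] it is the relation [phi z = [~ e1, e2]]. *)
have psi1_y u : psi1 (y_fun u) = psi1 u ^ e2.
  move: u; apply: semi_ext => [u v | u v | a |].
  - by rewrite y_funM psi1M.
  - by rewrite psi1M conjMg.
  - by rewrite y_fun_in !psi1_in.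
  - by rewrite y_fun_gen psi1M psi1_gen psi1_in phi_z commgEl mulKVg.
exists (semi_lift psi1 e2); split.
- exact: semi_liftM.
- by move=> a; rewrite semi_lift_in psi1_in.
- by rewrite semi_lift_in.
- exact: semi_lift_gen.
Qed.

End SemidirectInt2.

(** * Elements of prime power order *)

Lemma expg_gcd1 (G : groupType) (u : G) m n :
  0 < m -> u ^+ m = 1 -> u ^+ n = 1 -> u ^+ gcdn m n = 1.
Proof.
move=> m_gt0 um un; case: (egcdnP n m_gt0) => km kn E _.
have := congr1 (fun k => u ^+ k) E.
rewrite expgnDr (mulnC km) (mulnC kn) !expgnA um un !expg1n.
by rewrite mul1g.
Qed.

(** The gcds of [k] and [l] with [p ^ e] are powers [p ^ a] and [p ^ b], so one divides the other.
    If [a <= b], then [p ^ a] divides [l] and [u ^+ l = 1]; otherwise [p ^ b] divides [k] and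
    [v ^+ k = 1] directly. *)
Lemma expg_prime_power_cross (G : groupType) (u v : G) p e k l :
    prime p -> u ^+ (p ^ e) = 1 -> v ^+ (p ^ e) = 1 ->
  u ^+ k = 1 -> v ^+ l = 1 -> v ^+ k = (u ^+ l)^-1 -> v ^+ k = 1.
Proof.
move=> p_pr un vn uk vl vkul.
have n_gt0 : 0 < p ^ e by rewrite expn_gt0 prime_gt0.
have [a _ ga] : exists2 a, a <= e & gcdn (p ^ e) k = (p ^ a)%N.
  by apply/dvdn_pfactor; rewrite ?dvdn_gcdl.
have [b _ gb] : exists2 b, b <= e & gcdn (p ^ e) l = (p ^ b)%N.
  by apply/dvdn_pfactor; rewrite ?dvdn_gcdl.
have upa : u ^+ (p ^ a) = 1 by rewrite -ga expg_gcd1.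
have vpb : v ^+ (p ^ b) = 1 by rewrite -gb expg_gcd1.
have [le_ab | /ltnW le_ba] := leqP a b.
  rewrite vkul; have /dvdnP[q ->] : p ^ a %| l.
    by rewrite (dvdn_trans (dvdn_exp2l p le_ab)) // -gb dvdn_gcdr.
  by rewrite mulnC expgnA upa expg1n invg1.
have /dvdnP[q ->] : p ^ b %| k.
  by rewrite (dvdn_trans (dvdn_exp2l p le_ba)) // -ga dvdn_gcdr.
by rewrite mulnC expgnA vpb expg1n.
Qed.

(** * Subgroups of arbitrary groups as types *)

Section SubgroupType.

Variables (G : groupType) (S : {pred G}) (S_closed : group_closed S).

Definition subgroup_type of group_closed S := {x : G | x \in S}.
Local Notation sgT := (subgroup_type S_closed).

HB.instance Definition _ := SubChoice.on sgT.
HB.instance Definition _ := SubChoice_isSubGroup.Build G S sgT S_closed.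

Definition subgroup_val (x : sgT) : G := val x.
Definition subgroup_in (x : G) (Sx : x \in S) : sgT := Sub x Sx.

Lemma subgroup_valM : {morph subgroup_val : x y / x * y}.
Proof. exact: valM. Qed.

Lemma subgroup_val_inj : injective subgroup_val.
Proof. exact: val_inj. Qed.

Lemma subgroup_valP x : subgroup_val x \in S.
Proof. exact: valP. Qed.

Lemma subgroup_inK x (Sx : x \in S) : subgroup_val (subgroup_in Sx) = x.
Proof. exact: SubK. Qed.

End SubgroupType.

(** * Construction of the group [H] from A x D *)

Section CentralLift.

Variables (E D : groupType) (j : D -> E) (x y : E) (z : D).
Variables (cx cy : automorphism D).
Hypotheses (jM : {morph j : a b / a * b}) (j_inj : injective j).
Hypotheses (DC : forall a b : D, commute a b) (jz : j z = [~ x, y]).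
Hypotheses (jx : forall d, j (cx d) = j d ^ x)
  (jy : forall d, j (cy d) = j d ^ y).

(** For [cx] and [cy] these are the commutators of d with x and y, as [j] shows; they are
    multiplicative in d because [D] is abelian. *)
Let comm_by (c : automorphism D) d := d^-1 * c d.

Let comm_byM c : {morph comm_by c : a b / a * b}.
Proof.
move=> a b; rewrite /comm_by invgM aut_M !mulgA; congr (_ * _).
by rewrite -mulgA; apply: DC.
Qed.

(** In terms of the relations attached to [d1] and [d2] below: no nontrivial d has both (d, 1) and
    (1, d) among the relations. [axy_inj] is the resulting statement about A. *)
Hypothesis cross : forall d1 d2,
  comm_by cx d1 = 1 -> comm_by cy d2 = 1 ->
  comm_by cy d1 = (comm_by cx d2)^-1 -> comm_by cy d1 = 1.

(** The products x y and y x differ by [j z], which acts trivially on the abelian group [D]. *)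
Let cxyC d : cx (cy d) = cy (cx d).
Proof.
apply: j_inj; rewrite jy !jx -[in RHS]conjgM commgC -jz !conjgM -jy -jx.
by rewrite -(morph_mulJ jM) /conjg (DC _ z) mulKg.
Qed.

(* These relations are the universal choice making the actions of the lifts of
   x and y on A x D commute, i.e. making [d, x, y] = [d, y, x] hold in H. *)
Let rel_fun d : (D * D)%type := (comm_by cy d, (comm_by cx d)^-1).

Let rel_funM : {morph rel_fun : a b / a * b}.
Proof.
by move=> a b; rewrite /rel_fun !comm_byM invgM (DC (comm_by cx b)^-1).
Qed.

Let rel_mem : {pred D * D} := [pred q | `[< exists d, q = rel_fun d >]].

Let rel_memP q : reflect (exists d, q = rel_fun d) (q \in rel_mem).
Proof. exact: asboolP. Qed.

Let rel1 : 1 \in rel_mem.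
Proof. by apply/rel_memP; exists 1; rewrite (morph_mul1 rel_funM). Qed.

Let relM q r : q \in rel_mem -> r \in rel_mem -> q * r \in rel_mem.
Proof.
move=> /rel_memP[a ->] /rel_memP[b ->]; apply/rel_memP; exists (a * b).
by rewrite rel_funM.
Qed.

Let relV q : q \in rel_mem -> q^-1 \in rel_mem.
Proof.
move=> /rel_memP[a ->]; apply/rel_memP; exists a^-1.
by rewrite (morph_mulV rel_funM).
Qed.

Let DDC (q r : (D * D)%type) : commute q r.
Proof. by case: q r => [a b] [c d]; congr (_, _); apply: DC. Qed.

Let relJ q r : q \in rel_mem -> q ^ r \in rel_mem.
Proof. by rewrite /conjg (DDC q) mulKg. Qed.

Let A : groupType := Defs.quotient_group (NormalSubgroup rel1 relM relV relJ).
Let pi : D * D -> A := @quotient_pi _ _.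

Let piM : {morph pi : q r / q * r}.
Proof. exact: quotient_piM. Qed.

Let AC (a b : A) : commute a b.
Proof.
rewrite -(quotient_pi_repr a) -(quotient_pi_repr b) /commute -!quotient_piM.
by rewrite DDC.
Qed.

Let ax d : A := pi (d, 1).
Let ay d : A := pi (1, d).

Let axM : {morph ax : a b / a * b}.
Proof. by move=> a b; rewrite /ax -piM; congr (pi (_, _)); rewrite mulg1. Qed.

Let ayM : {morph ay : a b / a * b}.
Proof. by move=> a b; rewrite /ay -piM; congr (pi (_, _)); rewrite mulg1. Qed.

Let axy_comm d : ax (comm_by cy d) = ay (comm_by cx d).
Proof.
apply/quotient_piP/rel_memP; exists d^-1; rewrite (morph_mulV rel_funM).
by congr (_, _); rewrite /= ?mulg1 ?invg1 ?mul1g ?invgK.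
Qed.

Let axy_inj d : ax d = 1 -> ay d = 1 -> d = 1.
Proof.
move=> /quotient_pi_eq1/rel_memP[d1 [-> c1]].
move=> /quotient_pi_eq1/rel_memP[d2 [c2 e2]].
by apply: cross e2 => //; apply: (can_inj invgK); rewrite -c1 invg1.
Qed.

Let N : groupType := (A * D)%type.

Section Shear.

Variables (c : automorphism D) (h : D -> A).
Hypothesis hM : {morph h : a b / a * b}.

Let shear (n : N) : N := (n.1 * h n.2, c n.2).
Let shear_inv (n : N) : N := (n.1 * (h (aut_inv c n.2))^-1, aut_inv c n.2).

Let shearM : {morph shear : m n / m * n}.
Proof.
move=> [a d] [b e]; congr (_, _); last exact: aut_M.
rewrite /= hM !mulgA; congr (_ * _).
by rewrite -!mulgA (AC b).
Qed.

Let shearK : cancel shear shear_inv.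
Proof. by move=> [a d]; rewrite /shear_inv /shear /= aut_K mulgK. Qed.

Let shearVK : cancel shear_inv shear.
Proof. by move=> [a d]; rewrite /shear_inv /shear /= aut_VK mulgVK. Qed.

Definition shear_aut : automorphism N := Automorphism shearM shearK shearVK.

End Shear.

Let sx := shear_aut cx axM.
Let sy := shear_aut cy ayM.

Let NC (m n : N) : commute m n.
Proof. by case: m n => [a b] [c d]; congr (_, _); [apply: AC | apply: DC]. Qed.

(** In the component in [A] the two sides differ by [ax (comm_by cy d)] against [ay (comm_by cx d)],
    which the relations identify. *)
Let sxyC n : sx (sy n) = sy (sx n).
Proof.
case: n => a d; congr (_, _); last exact: cxyC.
have cE (c : automorphism D) : c d = d * comm_by c d by rewrite /comm_by mulVKg.
rewrite /= !cE axM ayM axy_comm -!mulgA; congr (_ * _).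
by rewrite [RHS]mulgA (AC (ax d) (ay d)) mulgA.
Qed.

(** The last two clauses serve for the two inclusions between Z_2(H) and the preimage of Z(E). The
    first holds because [A] is central in [H], the second because a commutator centralized by [u]
    and [v] lies in [A]. *)
Lemma central_lift : exists (H : groupType) (psi : H -> E),
  [/\ {morph psi : a b / a * b}, exists h, psi h = x, exists h, psi h = y,
      forall h g, psi [~ h, g] = 1 -> forall t, commute [~ h, g] t
    & forall h, (forall g t, commute [~ h, g] t) ->
        commute (psi h) x /\ commute (psi h) y].
Proof.
have [H [i [u [v [[iM i_inj iu iv _] [comm_in genH lift]]]]]] :=
  rank2_extension (1, z) NC sxyC.
pose phi (n : N) := j n.2.
have [||||psi [psiM psi_i psi_u psi_v]] := lift E phi x y.
- by move=> [a d] [b e]; rewrite /phi jM.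
- by move=> [a d]; rewrite /phi jx.
- by move=> [a d]; rewrite /phi jy.
- exact: jz.
exists H, psi; split=> //; [by exists u | by exists v | |].
  (* A commutator lies in A x D; if [psi] kills it, its component in [D] is trivial, and [u] and [v]
     fix [A] pointwise. *)
  move=> h g; have [[a d] ->] := comm_in h g; rewrite psi_i /phi /=.
  rewrite -(morph_mul1 jM) => /j_inj ->; apply: genH.
  - apply/commgP/conjg_fixP; rewrite iu; congr (i (_, _)) => /=.
      by rewrite (morph_mul1 axM) mulg1.
    exact: (morph_mul1 (@aut_M _ cx)).
  - apply/commgP/conjg_fixP; rewrite iv; congr (i (_, _)) => /=.
      by rewrite (morph_mul1 ayM) mulg1.
    exact: (morph_mul1 (@aut_M _ cy)).
  - by move=> n; rewrite /commute -!iM NC.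
move=> h Zh; have psi_comm g : psi [~ h, g] = 1.
  have [[a d] E_hg] := comm_in h g; rewrite E_hg psi_i /phi /=.
  suff -> : d = 1 by apply: morph_mul1.
  have mulg_fix (B : groupType) (b c : B) : b * c = b -> c = 1.
    by move=> bc; apply: (mulgI b); rewrite mulg1.
  (* Invariance of (a, d) under [u] and [v] gives [a * ax d = a] and [a * ay d = a]. *)
  apply: axy_inj; apply: (mulg_fix _ a).
    have /commgP/conjg_fixP := Zh g u; rewrite E_hg iu => /i_inj.
    by case.
  have /commgP/conjg_fixP := Zh g v; rewrite E_hg iv => /i_inj.
  by case.
by split; apply/commgP/eqP; rewrite -?psi_u -?psi_v -morph_mulR.
Qed.

End CentralLift.

(** * Capable two-generated p-groups with central commutator *)

Lemma gen_closed_ind (K : finGroupType) (A : {set K}) (P : K -> Prop) :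
    P 1 -> (forall k l, P k -> P l -> P (k * l)) ->
  (forall k, k \in A -> P k) -> forall k, k \in <<A>> -> P k.
Proof.
move=> P1 PM PA k /gen_prodgP[n [c Ac ->]].
by elim/big_rec: _ => // i x _ Px; apply: PM => //; apply: PA.
Qed.

Section CapableTwoGenerated.

Variables (K : finGroupType) (p : nat) (a b : K).
Hypotheses (p_pr : prime p) (pK : p.-group [set: K]).
Hypotheses (genK : <<[set a; b]>> = [set: K]).
Hypothesis (ab_central : forall k, commute [~ a, b] k).

Let genK_ind (P : K -> Prop) : P 1 -> (forall k l, P k -> P l -> P (k * l)) ->
  P a -> P b -> forall k, P k.
Proof.
move=> P1 PM Pa Pb k.
apply: (@gen_closed_ind K [set a; b]); rewrite ?genK ?inE //.
by move=> c; rewrite !inE => /orP[] /eqP->.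
Qed.

Section CentralExtension.

Variables (E : groupType) (f : E -> K).
Hypotheses (fM : {morph f : x y / x * y})
  (f_surj : forall k, exists e, f e = k).
Hypothesis f_ker : forall e, f e = 1 <-> forall t, commute e t.

Variables (x y : E).
Hypotheses (fx : f x = a) (fy : f y = b).

Let z := [~ x, y].
Let fz : f z = [~ a, b].
Proof. by rewrite (morph_mulR fM) fx fy. Qed.

(** This preimage is <z> Z(E), as [f] maps [z] to [[~ a, b]] and has kernel Z(E); see [S_decomp]. *)
Let S : {pred E} := [pred d | f d \in cycle [~ a, b]].

Let S_closed : group_closed S.
Proof.
split=> [|d e]; rewrite !inE; first by rewrite (morph_mul1 fM) group1.
by move=> Sd Se; rewrite fM (morph_mulV fM) groupM ?groupV.
Qed.

Let D : groupType := subgroup_type S_closed.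
Let j : D -> E := @subgroup_val _ _ S_closed.

Let jM : {morph j : c d / c * d} := @subgroup_valM _ _ S_closed.
Let j_inj : injective j := @subgroup_val_inj _ _ S_closed.

Let S_z : z \in S.
Proof. by rewrite inE fz cycle_id. Qed.

Let S_decomp d : d \in S -> exists k c, d = z ^+ k * c /\ forall t, commute c t.
Proof.
rewrite inE => /cycleP[k fd]; exists k, (z ^- k * d).
split; first by rewrite mulVKg.
by apply/f_ker; rewrite fM (morph_mulV fM) (morph_mulX fM) fz fd mulVg.
Qed.

Let DC (c d : D) : commute c d.
Proof.
apply: j_inj; rewrite !jM.
have [k [c' [Ec Zc]]] := S_decomp (subgroup_valP c).
have [l [d' [Ed Zd]]] := S_decomp (subgroup_valP d).
rewrite [j c]Ec [j d]Ed.
apply: commuteM; last exact/commute_sym/Zd.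
apply/commute_sym/commuteM; last exact/commute_sym/Zc.
exact: commuteX2.
Qed.

Let S_J d e : d \in S -> d ^ e \in S.
Proof.
move=> /S_decomp[k [c [-> Zc]]]; rewrite inE (morph_mulJ fM) fM.
have -> : f c = 1 by apply/f_ker.
rewrite mulg1 (morph_mulX fM) fz.
have -> : [~ a, b] ^+ k ^ f e = [~ a, b] ^+ k.
  by apply/conjg_fixP/commgP/commute_sym/commuteX/commute_sym.
by rewrite mem_cycle.
Qed.

Let conjD e (d : D) : D := subgroup_in S_closed (S_J e (subgroup_valP d)).

Let conjDE e d : j (conjD e d) = j d ^ e.
Proof. exact: subgroup_inK. Qed.

Let conjDM e : {morph conjD e : c d / c * d}.
Proof. by move=> c d; apply: j_inj; rewrite jM !conjDE jM conjMg. Qed.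

Let conjDK e : cancel (conjD e) (conjD e^-1).
Proof. by move=> d; apply: j_inj; rewrite !conjDE conjgK. Qed.

Let conjDVK e : cancel (conjD e^-1) (conjD e).
Proof. by move=> d; apply: j_inj; rewrite !conjDE conjgKV. Qed.

Let conjA e : automorphism D :=
  Automorphism (@conjDM e) (@conjDK e) (@conjDVK e).

(** [f t] is central in [K], so [[~ t, e]] lies in the kernel of [f], which is Z(E). *)
Let central_zcomm t e : f t = [~ a, b] -> forall s, commute [~ t, e] s.
Proof.
move=> ft; apply/f_ker; rewrite (morph_mulR fM) ft.
exact/eqP/commgP.
Qed.

Let commX c k e : (forall t, commute c t) -> [~ z ^+ k * c, e] = [~ z, e] ^+ k.
Proof.
move=> Zc; have Zw := central_zcomm e fz.
have ce : c ^ e = c by apply/conjg_fixP/commgP.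
have zke : (z ^+ k) ^ e = z ^+ k * [~ z, e] ^+ k.
  rewrite conjXg -expgMn; last exact/commute_sym/Zw.
  by rewrite commgEl mulVKg.
rewrite commgEl conjMg ce zke -(mulgA _ _ c).
by rewrite -(Zc ([~ z, e] ^+ k)) (mulgA (z ^+ k)) mulKg.
Qed.

(** The power of [z] with exponent [#|K|] lies in the kernel Z(E), so its commutator with [e] is
    trivial; that commutator is the same power of [[~ z, e]]. *)
Let comm_orderE e : [~ z, e] ^+ #|K| = 1.
Proof.
have Zzn : forall t, commute (z ^+ #|K|) t.
  apply/f_ker; rewrite (morph_mulX fM) -cardsT; apply: expg_cardG.
  by rewrite inE.
rewrite -(commX #|K| e (fun t => commute_sym (commute1 t))) mulg1.
by apply/eqP/commgP.
Qed.

Lemma central_extension_capable2 : capable 2 K.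
Proof.
have [n cardK] : exists n, #|K| = (p ^ n)%N.
  by rewrite -cardsT; have [n ->] := p_natP pK; exists n.
pose zD : D := subgroup_in S_closed S_z.
have [|H [psi [psiM [u psi_u] [v psi_v] psi_ker psi_Z2]]] :=
    central_lift (x := x) (y := y) (z := zD) (cx := conjA x) (cy := conjA y)
      jM j_inj DC erefl (conjDE x) (conjDE y).
  (* This is the condition [cross]. With [d1] and [d2] congruent to [z ^+ k] and [z ^+ l] modulo
     Z(E), it becomes a statement on powers of [[~ z, x]] and [[~ z, y]]. *)
  move=> d1 d2 c1 c2 c12.
  have [k [e1 [E1 Z1]]] := S_decomp (subgroup_valP d1).
  have [l [e2 [E2 Z2]]] := S_decomp (subgroup_valP d2).
  have commE e d : j (d^-1 * conjA e d) = [~ j d, e].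
    by rewrite jM (morph_mulV jM) conjDE.
  have jd1 e : j (d1^-1 * conjA e d1) = [~ z, e] ^+ k.
    by rewrite commE [j d1]E1 commX.
  have jd2 e : j (d2^-1 * conjA e d2) = [~ z, e] ^+ l.
    by rewrite commE [j d2]E2 commX.
  apply: j_inj; rewrite jd1 (morph_mul1 jM).
  apply: (@expg_prime_power_cross _ [~ z, x] [~ z, y] p n k l) => //.
  - by rewrite -cardK comm_orderE.
  - by rewrite -cardK comm_orderE.
  - by rewrite -jd1 c1 (morph_mul1 jM).
  - by rewrite -jd2 c2 (morph_mul1 jM).
  - by rewrite -jd1 c12 (morph_mulV jM) jd2.
apply/capableP; exists H, (f \o psi); split=> [g h | k | h] /=.
- by rewrite psiM fM.
- move: k; apply: genK_ind => [|k l [g <-] [h <-]||].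
  + by exists 1; rewrite (morph_mul1 psiM) (morph_mul1 fM).
  + by exists (g * h); rewrite psiM fM.
  + by exists u; rewrite psi_u.
  + by exists v; rewrite psi_v.
split=> [/f_ker Zh | /upper_central2P/psi_Z2[hx hy]].
  apply/upper_central2P => g t; apply: psi_ker.
  by rewrite (morph_mulR psiM); apply/eqP/commgP.
apply/f_ker => t.
(* As [a] and [b] generate [K], every [t] agrees modulo Z(E) with a product of copies of [x] and
   [y], and [psi h] commutes with both. *)
have: exists s, f s = f t /\ commute (psi h) s.
  move: (f t); apply: genK_ind => [|k l [s [<- hs]] [r [<- hr]]||].
  + by exists 1; rewrite (morph_mul1 fM); split=> //; apply: commute1.
  + by exists (s * r); rewrite fM; split=> //; apply: commuteM.
  + by exists x.
  + by exists y.
case=> s [fst hs]; rewrite -[t](mulVKg s); apply: commuteM => //.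
apply/commute_sym; apply/f_ker: (psi h).
by rewrite fM (morph_mulV fM) fst mulVg.
Qed.

End CentralExtension.

Lemma two_generated_capable2 : capable 1 K -> capable 2 K.
Proof.
move=> /capableP[E [f [fM f_surj f_ker]]].
have [x fx] := f_surj a; have [y fy] := f_surj b.
apply: (central_extension_capable2 fM _ fx fy) => e.
by rewrite f_ker upper_central1P.
Qed.

End CapableTwoGenerated.

(** The center of H / Z(H) is Z_2(H) / Z(H), so H / Z(H) is a witness for capability. *)
Lemma capable2_is_capable1 (K : groupType) : capable 2 K -> capable 1 K.
Proof.
move=> /capableP[H [f [fM f_surj f_ker]]].
pose Z1 := upper_central H 1; pose pi := @quotient_pi H Z1.
(* [f] kills Z(H), which makes [f \o repr] independent of representatives. *)
have f_pi x y : pi x = pi y -> f x = f y.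
  move/quotient_piP/upper_central1P => Zxy.
  suff: f (x^-1 * y) = 1.
    by rewrite fM morph_mulV // => /(congr1 ( *%g (f x))); rewrite mulVKg mulg1.
  apply/f_ker/upper_central2P => g t; have /commgP/eqP-> := Zxy g.
  exact/commute_sym/commute1.
apply/capableP; exists (Defs.quotient_group Z1), (f \o repr).
split=> [u v | k | u] /=.
- by rewrite -fM; apply: f_pi; rewrite /pi quotient_piM !quotient_pi_repr.
- have [h <-] := f_surj k; exists (pi h).
  by apply: f_pi; rewrite /pi quotient_pi_repr.
split=> [/f_ker/upper_central2P Z2u | /upper_central1P Zu].
  apply/upper_central1P => v.
  rewrite -(quotient_pi_repr u) -(quotient_pi_repr v).
  rewrite /commute -!quotient_piM; apply/esym/quotient_piP/upper_central1P.
  by move=> t; rewrite invgM -mulgA; apply: Z2u.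
apply/f_ker/upper_central2P => g; apply/upper_central1P.
have : commute (pi (repr u)) (pi g) by rewrite /pi quotient_pi_repr.
rewrite /commute -!quotient_piM.
by move/esym/quotient_piP; rewrite invgM -mulgA.
Qed.

(** * Capable quotients of a finite group *)

Section FiniteQuotients.

Variables (gT : finGroupType) (G : {group gT}).

(** [G] itself is the witness. This provides a first candidate for the epicenter. *)
Lemma capable1_center : capable 1 (subg_of (G / 'Z(G))).
Proof.
have nZ : G \subset 'N('Z(G)) := normal_norm (center_normal G).
apply/capableP; exists (subg_of G).
exists (fun u => subg (G / 'Z(G)) (coset 'Z(G) (sgval u))).
have in_quo (u : subg_of G) : coset 'Z(G) (sgval u) \in G / 'Z(G).
  by rewrite mem_quotient ?subgP.
have in_norm (u : subg_of G) : sgval u \in 'N('Z(G)).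
  by rewrite (subsetP nZ) ?subgP.
split=> [u v | k | u].
- by rewrite /= morphM ?in_norm // subgM ?in_quo.
- have /morphimP[g Ng Gg E] := subgP k.
  by exists (subg G g); rewrite subgK // -E sgvalK.
split=> [u1 | /upper_central1P Zu].
  apply/upper_central1P => v.
  have Zu : sgval u \in 'Z(G).
    by apply: coset_idr => //; rewrite -(subgK _ (in_quo u)) u1.
  by apply: val_inj; exact/commute_sym/(centerC (subgP v) Zu).
have Zu' : sgval u \in 'Z(G).
  apply/centerP; split; first exact: subgP.
  by move=> g Gg; have := congr1 sgval (Zu (subg G g)); rewrite /= subgK.
by rewrite coset_id // (morph1 (subg_morphism _)).
Qed.

Section OverQuotient.

Variables (N : {group gT}) (H : groupType) (f : H -> subg_of (G / N)).
Hypotheses (nNG : N <| G) (fM : {morph f : u v / u * v}).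
Hypothesis f_surj : forall k, exists h, f h = k.

(** The fibre product of [H] and [G] over G / N. *)
Definition over_quotient h g := (g \in G) && (sgval (f h) == coset N g).

Let nN : {subset G <= 'N(N)} := subsetP (normal_norm nNG).

Lemma over_quotient1 : over_quotient 1 1.
Proof.
by rewrite /over_quotient group1 (morph_mul1 fM) [coset N 1]morph1 /=.
Qed.

Lemma over_quotientF h k g g' :
  over_quotient h g -> over_quotient k g' ->
  over_quotient (h * k^-1) (g * g'^-1).
Proof.
case/andP=> Gg /eqP hg /andP[Gg' /eqP kg].
rewrite /over_quotient groupM ?groupV // fM (morph_mulV fM) /= hg kg.
by rewrite morphM ?morphV ?groupV ?nN.
Qed.

Lemma over_quotient_ex h : exists g, over_quotient h g.
Proof.
have /morphimP[g _ Gg E] := subgP (f h).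
by exists g; rewrite /over_quotient Gg; apply/eqP.
Qed.

Lemma over_quotient_surj g : g \in G -> exists h, over_quotient h g.
Proof.
move=> Gg; have [h hE] := f_surj (subg (G / N) (coset N g)).
exists h; rewrite /over_quotient Gg hE subgK ?eqxx //; exact: mem_quotient.
Qed.

Lemma over_quotient_ker h g : over_quotient h g -> f h = 1 <-> g \in N.
Proof.
case/andP=> Gg /eqP hg; split=> [h1 | Ng].
  by apply: coset_idr; rewrite ?nN // -hg h1.
by apply: val_inj; rewrite /= [LHS]hg coset_id.
Qed.

End OverQuotient.

(** The witness is the fibre product of [H1], [H2] and [G]. Only the intersection is assumed
    central, so [N2] may be one of the normal subgroups in Z_2(G) that compete for the
    2-epicenter. *)
Lemma capable1_quotientI (N1 N2 : {group gT}) :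
    N1 <| G -> N2 <| G -> N1 :&: N2 \subset 'Z(G) ->
    capable 1 (subg_of (G / N1)) -> capable 1 (subg_of (G / N2)) ->
  capable 1 (subg_of (G / (N1 :&: N2))).
Proof.
move=> nN1 nN2 sZ /capableP[H1 [f1 [f1M f1_surj f1_ker]]].
move=> /capableP[H2 [f2 [f2M f2_surj f2_ker]]].
have nN12 : N1 :&: N2 <| G by apply: normalI.
pose S : {pred H1 * H2 * gT} :=
  [pred t | over_quotient f1 t.1.1 t.2 && over_quotient f2 t.1.2 t.2].
have S_closed : group_closed S.
  split=> [|u v /andP[u1 u2] /andP[v1 v2]]; rewrite inE.
    by rewrite !over_quotient1.
  by rewrite !over_quotientF.
pose val := @subgroup_val _ _ S_closed.
have valS t : val t \in S := subgroup_valP t.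
have valM : {morph val : u v / u * v} := @subgroup_valM _ _ S_closed.
pose Q := G / (N1 :&: N2).
have nN12s := subsetP (normal_norm nN12).
have valG t : (val t).2 \in G by have /andP[/andP[]] := valS t.
have in_quo t : coset (N1 :&: N2) (val t).2 \in Q by rewrite mem_quotient.
apply/capableP; exists (subgroup_type S_closed).
exists (fun t => subg Q (coset (N1 :&: N2) (val t).2)).
split=> [u v | k | u].
- by rewrite valM /= morphM ?nN12s // subgM ?in_quo.
- have /morphimP[g _ Gg E] := subgP k.
  have [h1 h1g] := over_quotient_surj f1_surj Gg.
  have [h2 h2g] := over_quotient_surj f2_surj Gg.
  have St : (h1, h2, g) \in S by apply/andP.
  by exists (subgroup_in S_closed St); rewrite /val subgroup_inK /= -E sgvalK.
have /andP[u1 u2] := valS u.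
have ker1 := over_quotient_ker nN1 u1; have ker2 := over_quotient_ker nN2 u2.
split=> [u_1 | /upper_central1P Zu].
  have Nu : (val u).2 \in N1 :&: N2.
    by apply: coset_idr; rewrite ?nN12s // -(subgK _ (in_quo u)) u_1.
  have /setIP[/ker1/f1_ker/upper_central1P Z1] := Nu.
  move=> /ker2/f2_ker/upper_central1P Z2.
  apply/upper_central1P => v; apply: subgroup_val_inj.
  have -> : subgroup_val (u * v) = val u * val v := valM u v.
  have -> : subgroup_val (v * u) = val v * val u := valM v u.
  congr (_, _, _); [exact: Z1 | exact: Z2 |].
  exact/commute_sym/(centerC (valG v) (subsetP sZ _ Nu)).
have Zval t1 t2 g : over_quotient f1 t1 g -> over_quotient f2 t2 g ->
    commute (val u) (t1, t2, g).
  move=> t1g t2g; have St : (t1, t2, g) \in S by apply/andP.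
  have := congr1 val (Zu (subgroup_in S_closed St)).
  by rewrite !valM /val subgroup_inK.
(* Every element of [H1] or [H2] occurs in some triple, so the first two components of a central
   triple are central. *)
have Nu : (val u).2 \in N1 :&: N2.
  apply/setIP; split.
    apply/ker1/f1_ker/upper_central1P => t1.
    have [g t1g] := over_quotient_ex f1 t1; have /andP[Gg _] := t1g.
    have [t2 t2g] := over_quotient_surj f2_surj Gg.
    by have := congr1 (fun t => t.1.1) (Zval _ _ _ t1g t2g).
  apply/ker2/f2_ker/upper_central1P => t2.
  have [g t2g] := over_quotient_ex f2 t2; have /andP[Gg _] := t2g.
  have [t1 t1g] := over_quotient_surj f1_surj Gg.
  by have := congr1 (fun t => t.1.2) (Zval _ _ _ t1g t2g).
by rewrite coset_id // (morph1 (subg_morphism _)).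
Qed.

(** The images of two generators of [G] generate the quotient, possibly with repetition, and their
    commutator stays central. *)
Lemma capable1_quotient_capable2 p (N : {group gT}) :
    prime p -> p.-group G -> 'm(G) = 2 -> nil_class G <= 2 -> N <| G ->
  capable 1 (subg_of (G / N)) -> capable 2 (subg_of (G / N)).
Proof.
move=> p_pr pG mG nilG nNG; have [B genB cardB] := grank_witness G.
have nN := normal_norm nNG.
have /cards2P[x [y [_ EB]]] : #|B| == 2 by rewrite cardB mG.
have [Gx Gy] : x \in G /\ y \in G.
  by rewrite -genB EB; split; apply: mem_gen; rewrite !inE eqxx ?orbT.
pose pi g : subg_of (G / N) := subg (G / N) (coset N g).
have piM : {in G &, {morph pi : g h / g * h}}.
  move=> g h Gg Gh; rewrite /pi morphM ?(subsetP nN) //.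
  by rewrite subgM ?mem_quotient.
have im_set : pi @: G = [set: subg_of (G / N)].
  apply/setP=> k; rewrite !inE; have /morphimP[g _ Gg E] := subgP k.
  by apply/imsetP; exists g; rewrite // /pi -E sgvalK.
pose phi : {morphism G >-> subg_of (G / N)} := Morphism piM.
have im_phi : phi @* G = [set: subg_of (G / N)].
  by rewrite morphimEdom im_set.
apply: (@two_generated_capable2 _ p (pi x) (pi y) p_pr).
- by rewrite -im_phi morphim_pgroup.
- have sBG : B \subset G by rewrite -genB subset_gen.
  rewrite -im_phi; have := morphim_gen phi sBG; rewrite genB => ->.
  by rewrite EB morphimU !morphim_set1.
move=> k; have : k \in phi @* G by rewrite im_phi inE.
case/morphimP => g _ Gg ->.
have -> : [~ pi x, pi y] = phi [~ x, y] by rewrite morphR.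
rewrite /commute -!morphM ?groupR //; congr (phi _).
have sGZ : G^`(1) \subset 'Z(G) by rewrite -nil_class2.
by have /centerP[_ ->] := subsetP sGZ _ (mem_commg Gx Gy).
Qed.

End FiniteQuotients.

Theorem theoremE (p : nat) (gT : finGroupType) (G : {group gT}) :
  prime p -> (p.-group G)%g -> 'm(G)%g = 2 -> nil_class G = 2 ->
  exists Z : {group gT}, is_epicenter G Z /\ is_epicenter2 G Z.
Proof.
move=> p_pr pG mG nilG.
pose P (N : {group gT}) :=
  `[< N \subset 'Z(G) /\ capable 1 (subg_of (G / N)) >].
have PZ : P 'Z(G)%G by apply/asboolP; split; [|apply: capable1_center].
(* A candidate of least order is contained in all others, because intersecting it with a competitor
   gives a candidate again. *)
case: (@arg_minnP _ _ P (fun N : {group gT} => #|N|) PZ) => Z.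
move=> /asboolP[sZ capZ] minZ.
(* [M] is only normal here, so the competitors for both epicenters are covered. *)
have minimal (M : {group gT}) :
    M <| G -> capable 1 (subg_of (G / M)) -> Z \subset M.
  move=> nM capM; have sI : Z :&: M \subset 'Z(G) by apply: subIset; rewrite sZ.
  have /minZ : P (Z :&: M)%G.
    apply/asboolP; split=> //; apply: capable1_quotientI => //.
    exact: sub_center_normal.
  rewrite /= => leZ; apply/setIidPl/eqP.
  by rewrite eqEcard subsetIl.
exists Z; split; split=> //.
- by move=> M [sM]; apply: minimal; apply: sub_center_normal.
- split; first exact: sub_center_normal.
    by rewrite (subset_trans sZ) // -ucn1 ucn_subS.
  apply: (capable1_quotient_capable2 p_pr) => //; rewrite ?nilG //.
  exact: sub_center_normal.
by move=> M [nM _ /capable2_is_capable1]; apply: minimal.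
Qed.
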